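(* Let $t$ be an indeterminate and, for $n\geq 2$, let $\eta_1:T_n\rightarrow\mathrm{GL}_n(\mathbb{Z}[t^{\pm1}])$ be the representation of the twin group $T_n$ given, for $1\leq i\leq n-1$, by $$\eta_1(s_i)=\left(\begin{array}{c|c|c} I_{i-1} & 0 & 0\\ \hline 0 & \begin{matrix}1-t & t\\ 2-t & t-1\end{matrix} & 0\\ \hline 0&0&I_{n-i-1}\end{array}\right).$$ Then $\eta_1$ is faithful (injective) for $n=2$ and for $n=3$.
   Context: For $n\geq 2$, the twin group $T_n$ is the group with generators $s_1,\ldots,s_{n-1}$ and defining relations $s_i^2=1$ for $1\leq i\leq n-1$, and $s_is_j=s_js_i$ for $|i-j|\geq 2$. $I_r$ is the $r\times r$ identity matrix. *)

(* Defs.v *)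
From HB Require Import structures.
From mathcomp Require Import all_boot all_order all_algebra.
From mathcomp Require Import boolp.
From mathcomp Require Import ring zify.

Set Implicit Arguments.
Unset Strict Implicit.
Unset Printing Implicit Defensive.

Import GRing.Theory.

Section Presentation.
Local Open Scope quotient_scope.
Local Open Scope group_scope.
Variables (X : choiceType).

(* The letter (x, false) stands for x, and (x, true) for the inverse of x. *)
Definition word : choiceType := seq (X * bool).

Variable R : word -> word -> Prop.

Inductive pres_eqv : word -> word -> Prop :=
| pres_refl u : pres_eqv u u
| pres_sym u v : pres_eqv u v -> pres_eqv v u
| pres_trans v u w : pres_eqv u v -> pres_eqv v w -> pres_eqv u w
| pres_cat u u' v v' :
    pres_eqv u u' -> pres_eqv v v' -> pres_eqv (u ++ v) (u' ++ v')
| pres_cancel x b : pres_eqv [:: (x, b); (x, ~~ b)] [::]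
| pres_rel u v : R u v -> pres_eqv u v.

Definition pres_eqvb : rel word := fun u v => `[< pres_eqv u v >].

Lemma pres_equiv_class : equiv_class_of pres_eqvb.
Proof.
split=> [u|u v|v u w].
- exact/asboolP/pres_refl.
- by apply/asboolP/asboolP; exact: pres_sym.
- by move=> /asboolP uv /asboolP vw; apply/asboolP; exact: pres_trans uv vw.
Qed.
Canonical pres_equiv := EquivRelPack pres_equiv_class.

(* The group with set of generators X and defining relations u = v for R u v. *)
Definition presented := {eq_quot pres_equiv}.
HB.instance Definition _ := Choice.on presented.
HB.instance Definition _ := EqQuotient.on presented.

Definition pres_class (w : word) : presented := \pi_presented w.

Lemma pres_classP u v : pres_class u = pres_class v <-> pres_eqv u v.
Proof.
by split=> [/eqmodP/asboolP//|uv]; apply/eqmodP/asboolP.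
Qed.

Lemma pres_repr u : pres_eqv (repr (pres_class u)) u.
Proof. by apply/pres_classP; rewrite /pres_class reprK. Qed.

Definition pres_gen (x : X) : presented := pres_class [:: (x, false)].

Definition word_inv (w : word) : word := rev [seq (l.1, ~~ l.2) | l <- w].

Definition pres_mul (a b : presented) : presented :=
  pres_class (repr a ++ repr b).
Definition pres_one : presented := pres_class [::].
Definition pres_inv (a : presented) : presented :=
  pres_class (word_inv (repr a)).

Lemma pres_mulE u v :
  pres_mul (pres_class u) (pres_class v) = pres_class (u ++ v).
Proof. by apply/pres_classP; apply: pres_cat; exact: pres_repr. Qed.

Lemma pres_ind (P : presented -> Prop) :
  (forall u, P (pres_class u)) -> forall a, P a.
Proof. by move=> Pc a; rewrite -(reprK a); exact: Pc. Qed.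

Fact pres_mulA : associative pres_mul.
Proof.
by elim/pres_ind=> u; elim/pres_ind=> v; elim/pres_ind=> w; rewrite !pres_mulE catA.
Qed.

Fact pres_mul1 : left_id pres_one pres_mul.
Proof. by elim/pres_ind=> u; rewrite pres_mulE. Qed.

Fact pres_mulr1 : right_id pres_one pres_mul.
Proof. by elim/pres_ind=> u; rewrite pres_mulE cats0. Qed.

Lemma word_invK : involutive word_inv.
Proof.
move=> w; rewrite /word_inv map_rev revK -map_comp -[RHS]map_id.
by apply: eq_map => -[x b] /=; rewrite negbK.
Qed.

Lemma word_invr u : pres_eqv (u ++ word_inv u) [::].
Proof.
elim: u => [|[x b] u IHu]; first exact: pres_refl.
rewrite /word_inv /= rev_cons -cats1 -/(word_inv u).
apply: pres_trans (pres_cancel x b).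
rewrite -cat1s -[X in pres_eqv _ X]cat1s; apply: pres_cat; first exact: pres_refl.
rewrite catA -[X in pres_eqv _ X]cat0s; apply: pres_cat => //.
exact: pres_refl.
Qed.

Lemma word_invl u : pres_eqv (word_inv u ++ u) [::].
Proof. by rewrite -{2}(word_invK u); exact: word_invr. Qed.

Fact pres_mulV : left_inverse pres_one pres_inv pres_mul.
Proof.
move=> a; rewrite -{2}(reprK a) pres_mulE.
by apply/pres_classP; exact: word_invl.
Qed.

Fact pres_mulrV : right_inverse pres_one pres_inv pres_mul.
Proof.
move=> a; rewrite -{1}(reprK a) pres_mulE.
by apply/pres_classP; exact: word_invr.
Qed.

HB.instance Definition _ := isGroup.Build presented
  pres_mulA pres_mul1 pres_mulr1 pres_mulV pres_mulrV.

Variables (G : groupType) (f : X -> G).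

Definition word_eval (w : word) : G :=
  \prod_(l <- w) (if l.2 then (f l.1)^-1 else f l.1).

Lemma word_eval_cat u v : word_eval (u ++ v) = word_eval u * word_eval v.
Proof. by rewrite /word_eval big_cat. Qed.

(* The value at any representative word; a morphism extending f as soon as f  *)
(* satisfies the relations (hypothesis fR below).                             *)
Definition pres_lift (a : presented) : G := word_eval (repr a).

Hypothesis fR : forall u v, R u v -> word_eval u = word_eval v.

Lemma word_eval_eqv u v : pres_eqv u v -> word_eval u = word_eval v.
Proof.
elim=> {u v} // [v u w _ -> _ -> //|u u' v v' _ e _ e'|x b].
  by rewrite !word_eval_cat e e'.
by rewrite /word_eval !big_cons big_nil; case: b; rewrite /= mulg1 (mulVg, mulgV).
Qed.

Lemma pres_lift_class u : pres_lift (pres_class u) = word_eval u.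
Proof. exact/word_eval_eqv/pres_repr. Qed.

Lemma pres_liftM : {morph pres_lift : a b / a * b}.
Proof.
elim/pres_ind=> u; elim/pres_ind=> v.
by rewrite [_ * _]pres_mulE !pres_lift_class word_eval_cat.
Qed.

Lemma pres_lift_monoid_morphism : monoid.monoid_morphism pres_lift.
Proof.
by split; [rewrite [1]/(pres_class [::]) pres_lift_class /word_eval big_nil
          |exact: pres_liftM].
Qed.

Lemma pres_lift_gen x : pres_lift (pres_gen x) = f x.
Proof. by rewrite pres_lift_class /word_eval big_seq1. Qed.

End Presentation.

Section TwinGroup.
Local Open Scope nat_scope.
Variable n : nat.

(* The generators s_1, ..., s_(n-1) are indexed from 0 by 'I_n.-1. *)
Inductive twin_rel : word 'I_n.-1 -> word 'I_n.-1 -> Prop :=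
| twin_sq (i : 'I_n.-1) : twin_rel [:: (i, false); (i, false)] [::]
| twin_comm (i j : 'I_n.-1) : 2 <= `|(i : nat) - (j : nat)| ->
    twin_rel [:: (i, false); (j, false)] [:: (j, false); (i, false)].

Definition twin : groupType := presented twin_rel.

Definition twin_gen (i : 'I_n.-1) : twin := pres_gen twin_rel i.

End TwinGroup.

Section Laurent.
Local Open Scope ring_scope.

Local Notation "x %:F" := (@FracField.tofrac _ x).

Definition laurent_pred : {pred {fraction {poly int}}} :=
  fun x => `[< exists (p : {poly int}) (k : nat), x = p%:F / ('X^k)%:F >].

Lemma tofracXn_neq0 k : ('X^k : {poly int})%:F != 0.
Proof. by rewrite tofrac_eq0 monic_neq0 ?monicXn. Qed.

Fact laurent_subring : subring_closed laurent_pred.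
Proof.
have X0 := tofracXn_neq0.
split.
- by apply/asboolP; exists 1, 0%N; rewrite expr0 divff ?tofrac1 ?oner_eq0.
- move=> _ _ /asboolP[p [k ->]] /asboolP[q [l ->]]; apply/asboolP.
  exists (p * 'X^l - q * 'X^k), (k + l)%N.
  by rewrite exprD tofracB !tofracM -mulNr addf_div ?X0 // mulNr.
- move=> _ _ /asboolP[p [k ->]] /asboolP[q [l ->]]; apply/asboolP.
  exists (p * q), (k + l)%N.
  by rewrite exprD !tofracM mulf_div.
Qed.
HB.instance Definition _ := GRing.isSubringClosed.Build _ laurent_pred laurent_subring.

(* Z[t^{+-1}], as the subring of the field of fractions of Z[t] consisting of *)
(* the quotients p / t^k.                                                     *)
Record laurent := Laurent
  { laurent_val :> {fraction {poly int}}; _ : laurent_val \in laurent_pred }.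

HB.instance Definition _ := [isSub for laurent_val].
HB.instance Definition _ := [Choice of laurent by <:].
HB.instance Definition _ := [SubChoice_isSubComNzRing of laurent by <:].

Definition laurent_unit : pred laurent := fun x => `[< exists y, y * x == 1 >].
Definition laurent_inv (x : laurent) : laurent :=
  if pselect (exists y, y * x == 1) is left e then xchoose e else x.

Fact laurent_mulVr : {in laurent_unit, left_inverse 1 laurent_inv *%R}.
Proof.
move=> x /asboolP ux; rewrite /laurent_inv; case: pselect => // e.
exact/eqP/(xchooseP e).
Qed.
Fact laurent_unitP (x y : laurent) : y * x = 1 -> laurent_unit x.
Proof. by move=> xy; apply/asboolP; exists y; apply/eqP. Qed.
Fact laurent_inv_out : {in [predC laurent_unit], laurent_inv =1 id}.
Proof.
by move=> x /asboolP ux; rewrite /laurent_inv; case: pselect.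
Qed.

HB.instance Definition _ := GRing.ComNzRing_hasMulInverse.Build laurent
  laurent_mulVr laurent_unitP laurent_inv_out.

Fact laurent_t_subproof : 'X%:F \in laurent_pred.
Proof. by apply/asboolP; exists 'X, 0%N; rewrite expr0 tofrac1 divr1. Qed.

Definition laurent_t : laurent := Laurent laurent_t_subproof.

End Laurent.

(* {'GL_n[R]} requires a finite R; GL n R is the group of units of 'M[R]_n    *)
(* for any commutative R.                                                     *)
Section GeneralLinearGroup.
Local Open Scope ring_scope.
Variables (n : nat) (R : comUnitRingType).

Record GL := GLmk { GLmx :> 'M[R]_n; _ : GLmx \in unitmx }.

HB.instance Definition _ := [isSub for GLmx].
HB.instance Definition _ := [Choice of GL by <:].

Lemma GLmx_unit (A : GL) : GLmx A \in unitmx. Proof. exact: valP A. Qed.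

Fact GL_mul_subproof (A B : GL) : A *m B \in unitmx.
Proof. by rewrite unitmx_mul !GLmx_unit. Qed.
Fact GL_inv_subproof (A : GL) : invmx A \in unitmx.
Proof. by rewrite unitmx_inv GLmx_unit. Qed.

Definition GL_mul (A B : GL) : GL := GLmk (GL_mul_subproof A B).
Definition GL_one : GL := GLmk (unitmx1 R n).
Definition GL_inv (A : GL) : GL := GLmk (GL_inv_subproof A).

Fact GL_mulA : associative GL_mul.
Proof. by move=> A B C; apply/val_inj/mulmxA. Qed.
Fact GL_mul1 : left_id GL_one GL_mul.
Proof. by move=> A; apply/val_inj/mul1mx. Qed.
Fact GL_mulr1 : right_id GL_one GL_mul.
Proof. by move=> A; apply/val_inj/mulmx1. Qed.
Fact GL_mulV : left_inverse GL_one GL_inv GL_mul.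
Proof. by move=> A; apply/val_inj/mulVmx/GLmx_unit. Qed.
Fact GL_mulrV : right_inverse GL_one GL_inv GL_mul.
Proof. by move=> A; apply/val_inj/mulmxV/GLmx_unit. Qed.

HB.instance Definition _ := isGroup.Build GL
  GL_mulA GL_mul1 GL_mulr1 GL_mulV GL_mulrV.

End GeneralLinearGroup.

Section Eta1.
Local Open Scope ring_scope.
Variable n : nat.
Local Notation t := laurent_t.

(* The nontrivial 2 x 2 block occupies the rows and columns i and i + 1,      *)
(* counted from 0.                                                            *)
Definition eta1_mx (i : 'I_n.-1) : 'M[laurent]_n :=
  \matrix_(j < n, k < n)
    if (j == i :> nat) && (k == i :> nat) then 1 - t
    else if (j == i :> nat) && (k == i.+1 :> nat) then t
    else if (j == i.+1 :> nat) && (k == i :> nat) then 2 - t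
    else if (j == i.+1 :> nat) && (k == i.+1 :> nat) then t - 1
    else (j == k)%:R.

Let u (i : 'I_n.-1) : 'cV[laurent]_n :=
  \col_j (if j == i :> nat then t else if j == i.+1 :> nat then t - 2 else 0).
Let v (i : 'I_n.-1) : 'rV[laurent]_n :=
  \row_k (if k == i :> nat then -1 else if k == i.+1 :> nat then 1 else 0).

Let eta1_mx_rank1 i : eta1_mx i = 1%:M + u i *m v i.
Proof.
apply/matrixP => j k; rewrite !mxE big_ord1 !mxE -[j == k]/(j == k :> nat).
move: (i : nat) (j : nat) (k : nat) => {}i {}j {}k.
have iS : (i == i.+1) = false by lia.
have Si : (i.+1 == i) = false by lia.
have [->|ji] := eqVneq j i; last first.
  have [->|jS] := eqVneq j i.+1; last by rewrite mul0r addr0.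
  have [->|ki] := eqVneq k i; first by rewrite Si /=; ring.
  by have [_|_] := eqVneq k i.+1; rewrite /=; ring.
have [_|ki] := eqVneq k i; first by rewrite /=; ring.
by rewrite iS; have [_|_] := eqVneq k i.+1; rewrite /=; ring.
Qed.

Let vu i : v i *m u i = (- 2)%:M.
Proof.
have i0 : (i < n)%N by have := ltn_ord i; lia.
have i1 : (i.+1 < n)%N by have := ltn_ord i; lia.
apply/matrixP => a b; rewrite !ord1 !mxE /=.
rewrite (bigD1 (Ordinal i0)) //= (bigD1 (Ordinal i1)) /=; last first.
  by rewrite -val_eqE /=; lia.
rewrite big1 => [|k /andP[k0 k1]]; rewrite !mxE ?eqxx /=.
  by rewrite gtn_eqF // mulr1n; ring.
move: k0 k1; rewrite -!val_eqE /= => /negbTE -> /negbTE ->; exact: mul0r.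
Qed.

Let vu_far (i j : 'I_n.-1) :
  (2 <= `|(i : nat) - (j : nat)|)%N -> v i *m u j = 0.
Proof.
move=> ij; apply/matrixP => a b; rewrite !mxE big1 // => k _; rewrite !mxE.
have [ki|_] := eqVneq (k : nat) i.
  have -> : (k == j :> nat) = false by lia.
  have -> : (k == j.+1 :> nat) = false by lia.
  by rewrite mulr0.
have [ki|_] := eqVneq (k : nat) i.+1; last by rewrite mul0r.
have -> : (k == j :> nat) = false by lia.
have -> : (k == j.+1 :> nat) = false by lia.
by rewrite mulr0.
Qed.

Lemma eta1_mx_sq i : eta1_mx i *m eta1_mx i = 1%:M.
Proof.
rewrite eta1_mx_rank1 mulmxDl !mulmxDr !mul1mx !mulmx1 -addrA.
rewrite mulmxA -(mulmxA (u i)) vu mul_mx_scalar -scalemxAl.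
by rewrite scaleNr scaler_nat mulr2n; set w := _ *m _; rewrite opprD !addrA
  addrK addrK.
Qed.

Lemma eta1_mx_comm (i j : 'I_n.-1) : (2 <= `|(i : nat) - (j : nat)|)%N ->
  eta1_mx i *m eta1_mx j = eta1_mx j *m eta1_mx i.
Proof.
move=> ij; have ji : (2 <= `|(j : nat) - (i : nat)|)%N by lia.
rewrite !eta1_mx_rank1 !mulmxDl !mulmxDr !mul1mx !mulmx1.
rewrite !mulmxA -(mulmxA (u i)) -(mulmxA (u j)) !vu_far // !mulmx0 !mul0mx.
by rewrite !addr0 -!addrA; congr (_ + _); rewrite addrC.
Qed.

Lemma eta1_mx_unit i : eta1_mx i \in unitmx.
Proof. by case: (mulmx1_unit (eta1_mx_sq i)). Qed.

(* A group morphism, with eta1 s_i = eta1_mx i: see the instance and eta1_gen *)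
(* below.                                                                     *)
Definition eta1 : twin n -> GL n laurent :=
  pres_lift (fun i : 'I_n.-1 => GLmk (eta1_mx_unit i)).

Let eta1_rel (w w' : word 'I_n.-1) : twin_rel w w' ->
  word_eval (fun i : 'I_n.-1 => GLmk (eta1_mx_unit i)) w =
  word_eval (fun i : 'I_n.-1 => GLmk (eta1_mx_unit i)) w'.
Proof.
case=> [i|i j ij]; rewrite /word_eval !big_cons !big_nil /= !mulg1.
  by apply/val_inj/eta1_mx_sq.
by apply/val_inj/eta1_mx_comm.
Qed.

HB.instance Definition _ := isUMagmaMorphism.Build (twin n) (GL n laurent) eta1
  (pres_lift_monoid_morphism eta1_rel).

Lemma eta1_gen i : GLmx (eta1 (twin_gen i)) = eta1_mx i.
Proof. by rewrite /eta1 pres_lift_gen. Qed.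

End Eta1.

(* Main.v *)
Require Import Defs.
From mathcomp Require Import all_boot all_order all_algebra.
From mathcomp Require Import ring zify.

(** The group [T_2] has order two, and [T_3] is the infinite dihedral group: each
    of their elements is a product of generators in which no letter is repeated
    twice in a row ([twin_reducedP]). Faithfulness thus means that a nonempty such
    product is not sent to the identity matrix.

    The matrices have polynomial entries in [t], so it is enough to see this after
    setting [t = 0]. For [n = 2] an entry [2 - t] becomes nonzero. For [n = 3] the
    differences [p = y - x] and [q = z - y] of the coordinates of a column vector
    [(x, y, z)] are transformed by
      [s_1 : (p, q) |-> (- p, q + 2 p)]  and  [s_2 : (p, q) |-> (p, - q)]
    so that the slope [r = q / p] undergoes the reflections [r |-> - 2 - r] and
    [r |-> - r] of the line, about [- 1] and [0]. These play ping-pong: the first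
    sends [r > - 1] into [r < - 1], the second sends [r < 0] into [r > 0].
    A nonempty reduced product therefore moves the slope [- 1 / 2], which lies
    between the two mirrors, out of the interval [[- 1, 0]]
    ([eta1_3_ping_pong]). *)

Set Implicit Arguments.
Unset Strict Implicit.
Unset Printing Implicit Defensive.

Import GRing.Theory.

Section ReducedWords.
Local Open Scope group_scope.
Variable n : nat.

Definition twin_prod (s : seq 'I_n.-1) : twin n := \prod_(i <- s) twin_gen i.

Definition reduced (s : seq 'I_n.-1) := sorted (fun i j => i != j) s.

Lemma twin_gen_sq (i : 'I_n.-1) : twin_gen i * twin_gen i = 1.
Proof. by rewrite [_ * _]pres_mulE; apply/pres_classP/pres_rel/twin_sq. Qed.

Lemma twin_letter (i : 'I_n.-1) b : pres_class (@twin_rel n) [:: (i, b)] = twin_gen i.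
Proof.
case: b => //; apply: (mulgI (twin_gen i)); rewrite twin_gen_sq.
by rewrite [_ * _]pres_mulE; apply/pres_classP/pres_cancel.
Qed.

(** The generators are involutions, so the inverse letters can be dropped, and a
    letter put in front of a reduced word either cancels its head or extends it. *)
Lemma twin_reducedP (a : twin n) : exists2 s, reduced s & a = twin_prod s.
Proof.
elim/pres_ind: a => w; elim: w => [|[i b] w [s red_s def_w]].
  by exists [::]; rewrite // /twin_prod big_nil.
have -> : pres_class (@twin_rel n) ((i, b) :: w) = twin_gen i * twin_prod s.
  by rewrite -def_w -(twin_letter i b) [_ * _]pres_mulE.
case: s red_s {def_w} => [|j s] red_s.
  by exists [:: i]; rewrite // /twin_prod big_seq1 big_nil mulg1.
have [<-|ij] := eqVneq i j; last first.
  by exists [:: i, j & s]; rewrite /reduced /= ?ij // /twin_prod !big_cons.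
exists s; first exact: path_sorted red_s.
by rewrite /twin_prod big_cons mulgA twin_gen_sq mul1g.
Qed.

Lemma eta1_prod_cons i s :
  GLmx (eta1 (twin_prod (i :: s))) = (eta1_mx i *m GLmx (eta1 (twin_prod s)))%R.
Proof. by rewrite /twin_prod big_cons gmulfM -eta1_gen. Qed.

Lemma eta1_prod_nil : GLmx (eta1 (twin_prod [::])) = 1%:M%R.
Proof. by rewrite /twin_prod big_nil gmulf1. Qed.

Lemma eta1_inj_reduced :
  (forall s, reduced s -> GLmx (eta1 (twin_prod s)) = 1%:M%R -> s = [::]) ->
  injective (@eta1 n).
Proof.
move=> ker1 a b eab; apply: (mulgI a^-1); rewrite mulVg; apply/esym.
have [s red_s def_s] := twin_reducedP (a^-1 * b).
rewrite def_s (ker1 s red_s) ?/twin_prod ?big_nil //.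
by rewrite -/(twin_prod s) -def_s gmulfM -[X in _ * X]/(eta1 b) -eab -gmulfM mulVg gmulf1.
Qed.

End ReducedWords.

Section Specialization.
Local Open Scope ring_scope.
Implicit Types (x y : laurent) (c d : int).

(** Evaluation at [t = 0], as a partial function on [Z[t^{+-1}]] defined on the
    polynomials in [t]; being a graph, it needs no choice of a polynomial. *)
Definition at0 x c :=
  exists2 p : {poly int}, laurent_val x = FracField.tofrac p & p.[0] = c.

(** Polynomials in [t] embed into the fraction field, so the polynomial is
    determined by its fraction. *)
Lemma at0_inj x c d : at0 x c -> at0 x d -> c = d.
Proof. by case=> p xp <- [q]; rewrite xp => /eqP; rewrite tofrac_eq => /eqP-> <-. Qed.

Lemma at0D x y c d : at0 x c -> at0 y d -> at0 (x + y) (c + d).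
Proof.
case=> p xp <- [q yq <-]; exists (p + q); last by rewrite hornerD.
by rewrite tofracD -xp -yq -[LHS]/(val (x + y)) rmorphD.
Qed.

Lemma at0M x y c d : at0 x c -> at0 y d -> at0 (x * y) (c * d).
Proof.
case=> p xp <- [q yq <-]; exists (p * q); last by rewrite hornerM.
by rewrite tofracM -xp -yq -[LHS]/(val (x * y)) rmorphM.
Qed.

Lemma at0N x c : at0 x c -> at0 (- x) (- c).
Proof.
case=> p xp <-; exists (- p); last by rewrite hornerN.
by rewrite tofracN -xp -[LHS]/(val (- x)) rmorphN.
Qed.

Lemma at0_nat m : at0 m%:R m%:R.
Proof.
exists m%:R; last by rewrite -polyC_natr hornerC.
by rewrite rmorph_nat -[LHS]/(val (m%:R : laurent)) rmorph_nat.
Qed.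

Lemma at0_t : at0 laurent_t 0.
Proof. by exists 'X; rewrite ?hornerX. Qed.

End Specialization.

Section Rank2.
Local Open Scope ring_scope.

Lemma eta1_2_inj : injective (@eta1 2).
Proof.
apply: eta1_inj_reduced => -[|i [|j s]] //= red_s.
  rewrite eta1_prod_cons eta1_prod_nil mulmx1 => /matrixP/(_ (inord 1) ord0).
  rewrite !mxE !ord1 -!val_eqE /= inordK //= => e.
  have := at0D (at0_nat 2) (at0N at0_t).
  by rewrite e => /(at0_inj (at0_nat 0)).
by move: red_s; rewrite /reduced /= !ord1 eqxx.
Qed.

End Rank2.

Section Rank3.
Local Open Scope ring_scope.
Local Notation t := laurent_t.
Implicit Types (V : 'cV[laurent]_3) (i : 'I_2) (s : seq 'I_2).

Let i0 : 'I_3 := inord 0.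
Let i1 : 'I_3 := inord 1.
Let i2 : 'I_3 := inord 2.

Definition diff01 V : laurent := V i1 ord0 - V i0 ord0.
Definition diff12 V : laurent := V i2 ord0 - V i1 ord0.

Lemma sum_I3 (F : 'I_3 -> laurent) : \sum_i F i = F i0 + F i1 + F i2.
Proof.
rewrite !big_ord_recr big_ord0 /= add0r.
by congr (F _ + F _ + F _); apply/val_inj; rewrite /= inordK.
Qed.

Lemma diff_eta1 i V :
  (diff01 (@eta1_mx 3 i *m V) = if i == 0 :> nat then - diff01 V
                               else diff01 V + t * diff12 V) *
  (diff12 (@eta1_mx 3 i *m V) = if i == 0 :> nat
                               then diff12 V + (2%:R - t) * diff01 V
                               else - diff12 V).
Proof.
rewrite /diff01 /diff12 !mxE !sum_I3 !mxE -!val_eqE /= !inordK //.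
by case: i => -[|[|//]] /= _; split; ring.
Qed.

(** Its differences [(2, - 1)] have the slope [- 1 / 2]. *)
Definition base_vector : 'cV[laurent]_3 :=
  \col_j (if j == i1 then 2%:R else if j == i2 then 1 else 0).

Lemma at0_diff01_base : at0 (diff01 base_vector) 2.
Proof.
rewrite /diff01 !mxE -!val_eqE /= !inordK //=.
exact: at0D (at0_nat 2) (at0N (at0_nat 0)).
Qed.

Lemma at0_diff12_base : at0 (diff12 base_vector) (- 1).
Proof.
rewrite /diff12 !mxE -!val_eqE /= !inordK //=.
exact: at0D (at0_nat 1) (at0N (at0_nat 2)).
Qed.

(** The position of the slope [q / p] after a product has been applied to
    [base_vector]: the letter applied last puts it below [-1] or above [0]. The
    inequalities are cleared of denominators by the factor [p ^+ 2]. *)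
Definition slope_in s (p q : int) : Prop :=
  match s with
  | [::] => p = 2 /\ q = - 1
  | i :: _ => if i == 0 :> nat then p * (p + q) < 0 else 0 < p * q
  end.

Lemma eta1_3_ping_pong s : reduced (n := 3) s ->
  let V := GLmx (eta1 (twin_prod (n := 3) s)) *m base_vector in
  exists p q, [/\ at0 (diff01 V) p, at0 (diff12 V) q & slope_in s p q].
Proof.
elim: s => [_|i s IHs red_s] /=.
  exists 2, (- 1); rewrite eta1_prod_nil mul1mx.
  by split=> //; [exact: at0_diff01_base | exact: at0_diff12_base].
have [p [q [Vp Vq]]] := IHs (path_sorted red_s).
rewrite eta1_prod_cons -mulmxA !diff_eta1; move: Vp Vq; set V := _ *m _ => Vp Vq.
have ij : if s is j :: _ then (i != j :> nat) else true.
  by case: s red_s {IHs V Vp Vq} => //= j s /andP[].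
have [i_0|i_1] := eqVneq (i : nat) 0%N => pq.
  exists (- p), (q + (2%:R - 0) * p); split; first exact: at0N.
    apply: at0D => //; apply: at0M => //.
    exact: at0D (at0_nat 2) (at0N at0_t).
  case: s ij pq {red_s IHs V Vp Vq} => [_ [-> ->] //|j s].
  by rewrite i_0 /= eq_sym => /negbTE->; nia.
exists (p + 0 * q), (- q); split; last 1 first.
- case: s ij pq {red_s IHs V Vp Vq} => [_ [-> ->] //|j s] /= ij.
  have -> : j == 0 :> nat by have := ltn_ord i; have := ltn_ord j; lia.
  by nia.
- exact/at0D/at0M/Vq/at0_t.
exact: at0N.
Qed.

Lemma eta1_3_inj : injective (@eta1 3).
Proof.
apply: eta1_inj_reduced => s red_s e.
have [p [q []]] := eta1_3_ping_pong red_s; rewrite e mul1mx.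
move=> /(at0_inj at0_diff01_base) <- /(at0_inj at0_diff12_base) <-.
by case: s {red_s e} => //= i s; case: ifP.
Qed.

End Rank3.

Theorem theorem9 : injective (@eta1 2) /\ injective (@eta1 3).
Proof. by split; [exact: eta1_2_inj | exact: eta1_3_inj]. Qed.
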